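(* Let $D,D'$ be Dedekind domains. If there is an order isomorphism $\psi\colon\mathcal{P}(D)\to\mathcal{P}(D')$, then there is an order isomorphism $\Psi\colon\mathrm{Rad}(D)\to\mathrm{Rad}(D')$ extending $\psi$ (that is, $\Psi(I)=\psi(I)$ for every $I\in\mathcal{P}(D)$).
   Context: A Dedekind domain means a one-dimensional (in particular, not a field) integrally closed Noetherian integral domain. For a Dedekind domain $D$, $\mathrm{Rad}(D)$ denotes the set of all nonzero radical ideals of $D$ (ideals $I\neq(0)$ with $I=\operatorname{rad}(I)$), partially ordered by containment, and $\mathcal{P}(D)\subseteq\mathrm{Rad}(D)$ denotes the subset of ideals of the form $\operatorname{rad}(xD)$ with $x\in D\setminus\{0\}$, with the induced order. An order isomorphism is a bijection that preserves and reflects the order. *)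

(* Defs.v *)
From HB Require Import structures.
From mathcomp Require Import all_boot all_order all_algebra.
From mathcomp Require Import boolp classical_sets functions.

Set Implicit Arguments.
Unset Strict Implicit.
Unset Printing Implicit Defensive.

Import GRing.Theory.
Local Open Scope classical_set_scope.
Local Open Scope ring_scope.

Section Ideals.
Variable D : idomainType.
Implicit Types (I P : set D) (x : D).

(* Unlike [idealr_closed], which excludes it, the unit ideal is an ideal here;
   it belongs to both [radical_ideals] and [principal_radicals] below. *)
Definition is_ideal I : Prop :=
  [/\ I 0, forall a b, I a -> I b -> I (a + b) & forall r a, I a -> I (r * a)].

Definition is_prime_ideal P : Prop :=
  [/\ is_ideal P, ~ P 1 & forall a b, P (a * b) -> P a \/ P b].

Definition radical I : set D := [set a | exists2 n, (0 < n)%N & I (a ^+ n)].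

Definition principal_ideal x : set D := [set x * r | r in [set: D]].

Definition ideal_span n (g : 'I_n -> D) : set D :=
  [set a | exists c : 'I_n -> D, a = \sum_(i < n) c i * g i].

(* A chain of length n has n + 1 members, P 0 through P n. *)
Definition is_prime_chain n (P : nat -> set D) : Prop :=
  (forall i, (i <= n)%N -> is_prime_ideal (P i)) /\
  (forall i, (i < n)%N -> P i `<` P i.+1).

End Ideals.

Definition krull_dim_eq (D : idomainType) (n : nat) : Prop :=
  (exists P : nat -> set D, is_prime_chain n P) /\
  (forall m (P : nat -> set D), is_prime_chain m P -> (m <= n)%N).

Definition noetherian (D : idomainType) : Prop :=
  forall I : set D, is_ideal I ->
    exists n (g : 'I_n -> D), I = ideal_span g.

Definition integrally_closed (D : idomainType) : Prop :=
  forall z : {fraction D}, integralOver (@tofrac D) z -> exists x : D, z = tofrac x.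

Definition dedekind (D : idomainType) : Prop :=
  [/\ krull_dim_eq D 1, integrally_closed D & noetherian D].

Definition radical_ideals (D : idomainType) : set (set D) :=
  [set I | [/\ is_ideal I, I <> [set 0] & I = radical I]].

Definition principal_radicals (D : idomainType) : set (set D) :=
  [set radical (principal_ideal x) | x in [set x : D | x <> 0]].

Arguments radical_ideals D : clear implicits.
Arguments principal_radicals D : clear implicits.

(* Only the values of f on A matter: a map A -> B is represented by any total
   function restricting to it. *)
Definition order_iso (T U : Type) (A : set (set T)) (B : set (set U))
    (f : set T -> set U) : Prop :=
  set_bij A B f /\
  (forall I J, A I -> A J -> (I `<=` J <-> f I `<=` f J)).

(* Main.v *)
Require Import Defs.
From mathcomp Require Import all_boot all_order all_algebra.
From mathcomp Require Import boolp classical_sets functions.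

(** A nonzero radical ideal is an intersection of nonzero primes, so it is enough
to match the nonzero primes of [D] with those of [D'] in a way that the order on
principal radicals already determines.

A nonzero prime [P] of [D] yields the set [U P] of principal radicals not
contained in [P]. The image of [U P] under [psi] lies in [U P'] for some nonzero
prime [P'] of [D'] ([transported_prime_reflect]). Otherwise each nonzero prime contains
[psi X] for some [X] in [U P]; take a nonzero [c] in [P] and write
[psi (rad c) = rad c']. Only finitely many primes are needed to cut out [rad c']
([finite_prime_decomposition]), so multiplying the generators of the finitely
many corresponding [X] gives an element [x] outside [P] with
[psi (rad x)] inside [psi (rad c)], whence [x] lies in [rad c] and so in [P], a
contradiction. Going back with the inverse of [psi] gives a prime [Q] with
[U P] contained in [U Q], that is [Q] inside [P]. Nonzero primes are maximal, so
[Q = P] and both inclusions are equalities: [psi X] lies in [P'] exactly when [X]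
lies in [P] ([transported_prime]).

The extension sends [I] to the intersection of the primes of [D'] that contain
[psi X] for every principal radical [X] inside [I]. If [Y] is not inside [I],
some prime [P] above [I] does not contain [Y], and the matching prime [P'] shows
that [psi Y] is not inside the image of [I]. Hence [psi Y] lies in the image of
[I] exactly when [Y] lies in [I] ([sub_extension]). Since a radical ideal is
determined by the principal radicals inside it, everything else is formal: the
order is preserved and reflected, the image of a principal radical [I] is
[psi I], and the same construction for the inverse of [psi] proves
surjectivity. *)

Set Implicit Arguments.
Unset Strict Implicit.
Unset Printing Implicit Defensive.

Import GRing.Theory.
Local Open Scope classical_set_scope.
Local Open Scope ring_scope.

(** * Ideals and their radicals *)

Section Ideals.
Variable D : idomainType.
Implicit Types (I J P : set D) (x y : D).

Lemma ideal_sum I (J : finType) (F : J -> D) :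
  is_ideal I -> (forall i, I (F i)) -> I (\sum_i F i).
Proof. by move=> [I0 ID _] IF; elim/big_ind: _. Qed.

Lemma prime_ideal_exp P x n : is_prime_ideal P -> P (x ^+ n) -> P x.
Proof.
move=> [_ P1 PM]; elim: n => [|n IHn]; first by rewrite expr0.
by rewrite exprS => /PM[].
Qed.

Lemma zero_ideal_prime : is_prime_ideal [set 0 : D].
Proof.
split; first split=> //= [a b -> ->|r a ->]; rewrite ?addr0 ?mulr0 //.
  by move=> /eqP; rewrite oner_eq0.
by move=> a b /= /eqP; rewrite mulf_eq0 => /orP[]/eqP; [left|right].
Qed.

Lemma ideal_neq0P I : is_ideal I -> I <> [set 0] <-> exists2 x, I x & x <> 0.
Proof.
move=> [I0 _ _]; split=> [nI|[x Ix x0] IE]; last by rewrite IE in Ix.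
apply: contrapT => nex; apply: nI; apply/seteqP; split=> [x Ix|_ ->] //.
by apply: contrapT => x0; apply: nex; exists x.
Qed.

Lemma principal_ideal_ideal x : is_ideal (principal_ideal x).
Proof.
split; first by exists 0 => //; rewrite mulr0.
  by move=> _ _ [r _ <-] [s _ <-]; exists (r + s); rewrite ?mulrDr.
by move=> s _ [r _ <-]; exists (s * r) => //; rewrite mulrCA.
Qed.

Lemma mem_principal_ideal x : principal_ideal x x.
Proof. by exists 1; rewrite ?mulr1. Qed.

Lemma sub_radical I : I `<=` radical I.
Proof. by move=> x Ix; exists 1. Qed.

Lemma mem_principal_radical x : radical (principal_ideal x) x.
Proof. exact/sub_radical/mem_principal_ideal. Qed.

Lemma principal_ideal_sub I x :
  is_ideal I -> principal_ideal x `<=` I <-> I x.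
Proof.
move=> [_ _ IM]; split=> [|Ix _ [r _ <-]]; last by rewrite mulrC; apply: IM.
by apply; apply: mem_principal_ideal.
Qed.

Lemma principal_radical_sub I x : is_ideal I -> I = radical I ->
  radical (principal_ideal x) `<=` I <-> I x.
Proof.
move=> iI rI; split; first by apply; apply: mem_principal_radical.
move=> /(principal_ideal_sub _ iI) xI y [n n0 yn]; rewrite rI.
by exists n => //; apply: xI.
Qed.

Lemma prime_radical P : is_prime_ideal P -> P = radical P.
Proof.
move=> pP; apply/seteqP; split=> [|x [n _]]; first exact: sub_radical.
exact: prime_ideal_exp.
Qed.

Lemma principal_radical_sub_prime P x : is_prime_ideal P ->
  radical (principal_ideal x) `<=` P <-> P x.
Proof.
move=> pP; apply: principal_radical_sub; last exact: prime_radical.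
by case: pP.
Qed.

Lemma principal_radicalM_subl x y :
  radical (principal_ideal (x * y)) `<=` radical (principal_ideal x).
Proof.
move=> z [n n0 [r _ zn]]; exists n => //.
by exists (y * r) => //; rewrite mulrA.
Qed.

Lemma principal_radicalM_subr x y :
  radical (principal_ideal (x * y)) `<=` radical (principal_ideal y).
Proof. by rewrite mulrC; apply: principal_radicalM_subl. Qed.

Lemma prime_meet_radical_ideal (F : set (set D)) :
  (forall P, F P -> is_prime_ideal P) ->
  is_ideal [set x | forall P, F P -> P x] /\
  [set x | forall P, F P -> P x] = radical [set x | forall P, F P -> P x].
Proof.
move=> pF; split.
  split=> [P /pF[[]]|a b Ia Ib P FP|r a Ia P FP] //.
    by have [[_ PD _] _ _] := pF P FP; apply: PD; [apply: Ia|apply: Ib].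
  by have [[_ _ PM] _ _] := pF P FP; apply: PM; apply: Ia.
apply/seteqP; split=> [|x [n _ In] P FP]; first exact: sub_radical.
exact: prime_ideal_exp (pF P FP) (In P FP).
Qed.

(** A radical ideal contains [rad x] with each of its elements [x], so the
principal radicals inside it determine it. *)
Lemma radical_ideal_sub_principal I J : radical_ideals D I -> radical_ideals D J ->
  (forall X, principal_radicals D X -> X `<=` I -> X `<=` J) -> I `<=` J.
Proof.
move=> [iI _ rI] [[J0 _ _] _ rJ] IJ x Ix.
have [->//|/eqP x0] := eqVneq x 0.
apply: (IJ (radical (principal_ideal x))); first by exists x.
  exact/principal_radical_sub.
exact: mem_principal_radical.
Qed.

Lemma radical_ideal_eq_principal I J : radical_ideals D I -> radical_ideals D J ->
  (forall X, principal_radicals D X -> X `<=` I <-> X `<=` J) -> I = J.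
Proof.
move=> rI rJ IJ; apply/seteqP.
by split; apply: radical_ideal_sub_principal => // X /IJ[].
Qed.

End Ideals.

(** * Noetherian induction and finite prime decompositions *)

Section Noetherian.
Variable D : idomainType.
Hypothesis noethD : noetherian D.
Implicit Types (I J P : set D) (x y : D).

(** The union of the chain has finitely many generators, which all lie in one
term; the chain is constant from there on. *)
Lemma noetherian_chain (C : nat -> set D) : (forall n, is_ideal (C n)) ->
  (forall n, C n `<=` C n.+1) -> exists n, C n.+1 `<=` C n.
Proof.
move=> iC CS.
have Cle m n : (m <= n)%N -> C m `<=` C n.
  move=> /subnK <-; elim: (n - m)%N => [|k IHk] //.
  by apply: subset_trans IHk _; rewrite addSn; apply: CS.
have iU : is_ideal [set x | exists n, C n x].
  split=> [|a b [m Cma] [n Cnb]|r a [n Cna]]; first by exists 0; case: (iC 0).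
    exists (maxn m n); have [_ CD _] := iC (maxn m n); apply: CD.
      exact: Cle (leq_maxl _ _) _ Cma.
    exact: Cle (leq_maxr _ _) _ Cnb.
  by exists n; have [_ _ CM] := iC n; apply: CM.
have [k [g Ug]] := noethD iU.
have Cg i : exists n, C n (g i).
  suff : [set x | exists n, C n x] (g i) by [].
  rewrite Ug; exists (fun j => (j == i)%:R).
  rewrite (bigD1 i) //= eqxx mul1r big1 ?addr0 // => j /negPf ->.
  by rewrite mul0r.
have /choice[f Cf] := Cg.
exists (\max_i f i) => x Cx.
have : [set x | exists n, C n x] x by exists (\max_i f i).+1.
rewrite Ug => -[c ->]; apply: ideal_sum => // i.
have [_ _ CM] := iC (\max_i f i); apply: CM.
exact: Cle (leq_bigmax _) _ (Cf i).
Qed.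

(** A counterexample would always have a strictly larger one above it, and
choosing repeatedly would produce a chain that never becomes constant. *)
Lemma noetherian_ind (Q : set D -> Prop) :
  (forall I, is_ideal I ->
     (forall J, is_ideal J -> I `<=` J -> ~ (J `<=` I) -> Q J) -> Q I) ->
  forall I, is_ideal I -> Q I.
Proof.
move=> step I iI; apply: contrapT => nQI.
pose bad := {J : set D | is_ideal J /\ ~ Q J}.
have /choice[next nextP] : forall B : bad, exists B' : bad,
    sval B `<=` sval B' /\ ~ (sval B' `<=` sval B).
  move=> [J [iJ nQJ]] /=; apply: contrapT => nex; apply: nQJ; apply: step => //.
  move=> K iK JK nKJ; apply: contrapT => nQK; apply: nex.
  by exists (exist _ K (conj iK nQK)).
pose C n := iter n next (exist _ I (conj iI nQI) : bad).
have [|n|n] := @noetherian_chain (fun n => sval (C n)).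
- by move=> n; case: (svalP (C n)).
- by have [] := nextP (C n).
- by have [_] := nextP (C n).
Qed.

Definition adjoin I x : set D := [set y | exists2 r, I r & exists s, y = r + s * x].

Lemma adjoin_ideal I x : is_ideal I -> is_ideal (adjoin I x).
Proof.
move=> [I0 ID IM]; split; first by exists 0 => //; exists 0; rewrite mul0r addr0.
  move=> _ _ [r Ir [s ->]] [r' Ir' [s' ->]]; exists (r + r'); first exact: ID.
  by exists (s + s'); rewrite mulrDl addrACA.
move=> t _ [r Ir [s ->]]; exists (t * r); first exact: IM.
by exists (t * s); rewrite mulrDr mulrA.
Qed.

Lemma sub_adjoin I x : I `<=` adjoin I x.
Proof. by move=> y Iy; exists y => //; exists 0; rewrite mul0r addr0. Qed.

Lemma mem_adjoin I x : is_ideal I -> adjoin I x x.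
Proof. by move=> [I0 _ _]; exists 0 => //; exists 1; rewrite mul1r add0r. Qed.

Lemma adjoinM I a b y z : is_ideal I -> I (a * b) ->
  adjoin I a y -> adjoin I b z -> I (y * z).
Proof.
move=> [_ ID IM] Iab [r Ir [s ->]] [r' Ir' [s' ->]].
rewrite mulrDr; apply: (ID); first exact: IM.
rewrite mulrDl; apply: ID; first by rewrite mulrC; apply: IM.
by rewrite mulrACA; apply: IM.
Qed.

(** By Noetherian induction: if [I] is proper and not prime, say [a * b] is in [I]
with neither factor in [I], then [I + aD] and [I + bD] have such lists, and since
their product lies in [I] the concatenated list works for [I]. Stating the
conclusion with the radical, rather than with a product of primes inside [I],
makes the order and the multiplicities of the primes irrelevant. *)
Lemma finite_prime_decomposition I : is_ideal I -> exists2 s : seq (set D),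
  {in s, forall P, is_prime_ideal P /\ I `<=` P} &
  forall y, {in s, forall P, P y} -> radical I y.
Proof.
move: I; apply: noetherian_ind => I iI IH.
have [I1|nI1] := pselect (I 1).
  exists [::] => // y _; apply: sub_radical.
  by have [_ _ IM] := iI; rewrite -[y]mulr1; apply: IM.
have [pI|npI] := pselect (is_prime_ideal I).
  exists [:: I] => [P|y]; first by rewrite mem_seq1 => /eqP ->; split.
  by move=> yI; apply: sub_radical; apply: yI; rewrite inE.
have [a [b [Iab nIa nIb]]] : exists a b, [/\ I (a * b), ~ I a & ~ I b].
  apply: contrapT => nex; apply: npI; split=> // a b Iab.
  apply: contrapT => /not_orP[nIa nIb]; apply: nex.
  by exists a, b.
have dec x : ~ I x -> exists2 s : seq (set D),
    {in s, forall P, is_prime_ideal P /\ adjoin I x `<=` P} &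
    forall y, {in s, forall P, P y} -> radical (adjoin I x) y.
  move=> nIx; apply: IH; [exact: adjoin_ideal|exact: sub_adjoin|].
  by move=> /(_ _ (mem_adjoin x iI)).
have [s sP sr] := dec a nIa; have [t tP tr] := dec b nIb.
exists (s ++ t) => [P|y yst].
  rewrite mem_cat => /orP[/sP|/tP] [pP IP]; split=> //;
  exact: subset_trans (@sub_adjoin _ _) IP.
have [|n n0 yn] := sr y; first by move=> P Ps; apply: yst; rewrite mem_cat Ps.
have [|m m0 ym] := tr y; first by move=> P Pt; apply: yst; rewrite mem_cat Pt orbT.
exists (n + m)%N; first by rewrite addn_gt0 n0.
by rewrite exprD; apply: adjoinM yn ym.
Qed.

Lemma radical_ideal_separation I x : is_ideal I -> I = radical I -> ~ I x ->
  exists P, [/\ is_prime_ideal P, I `<=` P & ~ P x].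
Proof.
move=> iI rI nIx; have [s sP sr] := finite_prime_decomposition iI.
apply: contrapT => nex; apply: nIx; rewrite rI; apply: sr => P /sP[pP IP].
by apply: contrapT => nPx; apply: nex; exists P.
Qed.

Lemma principal_radical_radical_ideal : principal_radicals D `<=` radical_ideals D.
Proof.
move=> _ [x x0 <-].
have [s sP sr] := finite_prime_decomposition (principal_ideal_ideal x).
have -> : radical (principal_ideal x) = [set y | forall P, P \in s -> P y].
  apply/seteqP; split=> [y yx P /sP[pP xP]|y /sr//].
  apply: (principal_radical_sub_prime x pP).2 yx.
  exact: xP (mem_principal_ideal x).
have [iI rI] := @prime_meet_radical_ideal _ [set P | P \in s] (fun P Ps => (sP P Ps).1).
split=> //; apply/(ideal_neq0P iI); exists x => // P /sP[_].
by apply; apply: mem_principal_ideal.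
Qed.

End Noetherian.

Lemma dim1_prime_maximal (D : idomainType) (P Q : set D) : krull_dim_eq D 1 ->
  is_prime_ideal P -> P <> [set 0] -> is_prime_ideal Q -> P `<=` Q -> P = Q.
Proof.
move=> [_ dim1] pP P0 pQ PQ; apply/seteqP; split=> //; apply: contrapT => nQP.
(* Otherwise [0 < P < Q] would be a chain of length two. *)
pose C i := if i is j.+1 then if j is _.+1 then Q else P else [set 0].
suff /dim1 : is_prime_chain 2 C by [].
split=> [[|[|i]] _ //|[|[|i]] //= _]; first exact: zero_ideal_prime.
  have [iP _ _] := pP; have [p Pp p0] := (ideal_neq0P iP).1 P0.
  by split=> [_ ->|/(_ p Pp)] //; case: iP.
Qed.

(** * Matching the primes of two domains *)

Definition transports (D D' : idomainType) (psi : set D -> set D')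
    (phi : set D' -> set D) : Prop :=
  [/\ forall X, principal_radicals D X -> principal_radicals D' (psi X),
      forall X, principal_radicals D X -> phi (psi X) = X &
      forall X Y, principal_radicals D X -> principal_radicals D Y ->
        X `<=` Y <-> psi X `<=` psi Y].

(** This is where finiteness enters: only finitely many primes of [D'] have to be
handled, and the complement of [P] is closed under finite products. *)
Lemma transported_prime_reflect (D D' : idomainType) psi phi (P : set D) :
  noetherian D' -> @transports D D' psi phi ->
  is_prime_ideal P -> P <> [set 0] ->
  exists P', [/\ is_prime_ideal P', P' <> [set 0] &
    forall X, principal_radicals D X -> psi X `<=` P' -> X `<=` P].
Proof.
move=> noethD' [psiA _ psi_le] pP P0; have [iP nP1 PM] := pP.
have [c Pc c0] := (ideal_neq0P iP).1 P0.
have Ac : principal_radicals D (radical (principal_ideal c)) by exists c.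
have [c' c'0 c'E] := psiA _ Ac.
have [s sP sr] := finite_prime_decomposition noethD' (principal_ideal_ideal c').
apply: contrapT => nex.
have nzP x : ~ P x -> x <> 0 by move=> nPx x0; apply: nPx; rewrite x0; case: iP.
(* The product of one witness for each prime above [c']. *)
have [x nPx xs] : exists2 x, ~ P x &
    {in s, forall P', psi (radical (principal_ideal x)) `<=` P'}.
  have {sr} : {in s, forall P', exists2 x, ~ P x &
      psi (radical (principal_ideal x)) `<=` P'}.
    move=> P' /sP[pP' cP']; apply: contrapT => nx; apply: nex; exists P'.
    split=> // [|X [x x0 <-] XP'].
      have [iP' _ _] := pP'; apply/(ideal_neq0P iP').
      by exists c' => //; apply: cP'; apply: mem_principal_ideal.
    apply/principal_radical_sub_prime => //; apply: contrapT => nPx.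
    by apply: nx; exists x.
  elim: s {sP} => [_|P' s IHs hs]; first by exists 1.
  have [x nPx xP'] := hs P' (mem_head _ _).
  have [|y nPy ys] := IHs; first by move=> Q Qs; apply: hs; rewrite inE Qs orbT.
  have nPxy : ~ P (x * y) by move=> /PM[].
  have Arad z : ~ P z -> principal_radicals D (radical (principal_ideal z)).
    by move=> /nzP z0; exists z.
  exists (x * y) => // Q; rewrite inE => /predU1P[->|/ys ysQ].
    apply: subset_trans xP'; apply/(psi_le _ _ (Arad _ nPxy) (Arad _ nPx)).
    exact: principal_radicalM_subl.
  apply: subset_trans ysQ; apply/(psi_le _ _ (Arad _ nPxy) (Arad _ nPy)).
  exact: principal_radicalM_subr.
have xc : radical (principal_ideal x) `<=` radical (principal_ideal c).
  apply/psi_le => //; first by exists x => //; apply: nzP.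
  by rewrite -c'E => y xy; apply: sr => P' /xs; apply.
apply: nPx; apply: (principal_radical_sub_prime c pP).2 Pc _ _.
exact: xc (mem_principal_radical x).
Qed.

(** Going back and forth gives a prime [Q] of [D] inside [P]; maximality forces
[Q = P], which turns the one-sided comparison into an equivalence. *)
Lemma transported_prime (D D' : idomainType) psi phi (P : set D) :
  krull_dim_eq D 1 -> noetherian D -> noetherian D' ->
  @transports D D' psi phi -> @transports D' D phi psi ->
  is_prime_ideal P -> P <> [set 0] ->
  exists P', [/\ is_prime_ideal P', P' <> [set 0] &
    forall X, principal_radicals D X -> psi X `<=` P' <-> X `<=` P].
Proof.
move=> dimD noethD noethD' Tpsi Tphi pP P0.
have [P' [pP' P'0 PP']] := transported_prime_reflect noethD' Tpsi pP P0.
have [Q [pQ Q0 P'Q]] := transported_prime_reflect noethD Tphi pP' P'0.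
have [psiA psiK _] := Tpsi.
have QP X : principal_radicals D X -> X `<=` Q -> psi X `<=` P'.
  by move=> AX XQ; apply: P'Q; [apply: psiA|rewrite psiK].
have QE : Q = P.
  apply: (dim1_prime_maximal dimD pQ Q0 pP) => x Qx.
  have [->|/eqP x0] := eqVneq x 0; first by case: pP => -[].
  have Ax : principal_radicals D (radical (principal_ideal x)) by exists x.
  apply/principal_radical_sub_prime => //; apply: PP' => //; apply: QP => //.
  exact/principal_radical_sub_prime.
exists P'; split=> // X AX; split; first exact: PP'.
by rewrite -QE; apply: QP.
Qed.

(** * The extension to radical ideals *)

Section Extension.
Variables (D D' : idomainType) (psi : set D -> set D') (phi : set D' -> set D).
Hypotheses (dimD : krull_dim_eq D 1).
Hypotheses (noethD : noetherian D) (noethD' : noetherian D').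
Hypotheses (Tpsi : transports psi phi) (Tphi : transports phi psi).

Definition primes_above (I : set D) : set (set D') :=
  [set P' | is_prime_ideal P' /\
     forall X, principal_radicals D X -> X `<=` I -> psi X `<=` P'].

(** Taking the intersection of primes, rather than the union of the [psi X] for
[X] inside [I], makes closure under addition immediate. *)
Definition extension (I : set D) : set D' :=
  [set y | forall P', primes_above I P' -> P' y].

Lemma sub_extension I X : principal_radicals D X -> radical_ideals D I ->
  psi X `<=` extension I <-> X `<=` I.
Proof.
move=> AX [iI I0 rI]; split=> [XI x Xx|XI y Xy P' [_ IP']]; last exact: IP' Xy.
apply: contrapT => nIx.
have [P [pP IP nPx]] := radical_ideal_separation noethD iI rI nIx.
have P0 : P <> [set 0].
  have [a Ia a0] := (ideal_neq0P iI).1 I0; have [iP _ _] := pP.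
  by apply/(ideal_neq0P iP); exists a => //; apply: IP.
have [P' [pP' _ PP']] := transported_prime dimD noethD noethD' Tpsi Tphi pP P0.
apply: nPx; apply: (PP' X AX).1 Xx => y /XI; apply; split=> // Y AY YI.
by apply/PP' => //; apply: subset_trans YI IP.
Qed.

Lemma extension_radical_ideal I :
  radical_ideals D I -> radical_ideals D' (extension I).
Proof.
move=> rI; have [iI I0 rIE] := rI.
have [iE rE] := @prime_meet_radical_ideal _ (primes_above I) (fun P => @proj1 _ _).
split=> //; apply/(ideal_neq0P iE).
have [a Ia a0] := (ideal_neq0P iI).1 I0.
have Aa : principal_radicals D (radical (principal_ideal a)) by exists a.
have [psiA _ _] := Tpsi; have [a' a'0 a'E] := psiA _ Aa.
exists a' => //; apply: (sub_extension Aa rI).2; last first.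
  by rewrite -a'E; apply: mem_principal_radical.
exact/principal_radical_sub.
Qed.

Lemma extension_le I J : radical_ideals D I -> radical_ideals D J ->
  I `<=` J <-> extension I `<=` extension J.
Proof.
move=> rI rJ; split=> [IJ y Iy P' [pP' JP']|IJ].
  by apply: Iy; split=> // X AX XI; apply: JP' => //; apply: subset_trans IJ.
apply: radical_ideal_sub_principal => // X AX XI.
by apply/sub_extension => //; apply: subset_trans IJ; apply/sub_extension.
Qed.

Lemma extension_unique I J : radical_ideals D I -> radical_ideals D' J ->
  (forall X, principal_radicals D X -> psi X `<=` J <-> X `<=` I) ->
  extension I = J.
Proof.
move=> rI rJ IJ; apply: radical_ideal_eq_principal => //.
  exact: extension_radical_ideal.
move=> X' AX'; have [phiA phiK _] := Tphi.
have AX := phiA _ AX'; rewrite -(phiK _ AX').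
by apply: iff_trans (sub_extension AX rI) _; apply: iff_sym; apply: IJ.
Qed.

End Extension.

(** Passing to an explicit inverse makes the two domains play symmetric roles, so
that each construction can be applied in both directions. *)
Lemma order_iso_transports (D D' : idomainType) (psi : set D -> set D') :
  order_iso (principal_radicals D) (principal_radicals D') psi ->
  exists phi, transports psi phi /\ transports phi psi.
Proof.
move=> [[psiA psi_inj psi_surj] psi_le].
have /choice[phi phiP] : forall Y, exists X, principal_radicals D' Y ->
    principal_radicals D X /\ psi X = Y.
  move=> Y; have [/psi_surj[X AX XY]|nAY] := pselect (principal_radicals D' Y).
    by exists X.
  by exists set0.
have psiA' X : principal_radicals D X -> principal_radicals D' (psi X).
  by move=> AX; apply: psiA.
exists phi; split; split=> //.
- move=> X AX; have [AX' XE] := phiP _ (psiA' X AX).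
  by apply: psi_inj => //; rewrite inE.
- by move=> Y /phiP[].
- by move=> Y /phiP[].
move=> X Y /phiP[AX XE] /phiP[AY YE].
by rewrite -{1}XE -{1}YE; apply: iff_sym; apply: psi_le.
Qed.

Theorem theorem3p6 (D D' : idomainType) (hD : dedekind D) (hD' : dedekind D')
    (psi : set D -> set D')
    (hpsi : order_iso (principal_radicals D) (principal_radicals D') psi) :
  exists Psi : set D -> set D',
    order_iso (radical_ideals D) (radical_ideals D') Psi /\
    (forall I : set D, principal_radicals D I -> Psi I = psi I).
Proof.
have [phi [Tpsi Tphi]] := order_iso_transports hpsi.
have [dimD _ noethD] := hD; have [dimD' _ noethD'] := hD'.
have ext_le := extension_le dimD noethD noethD' Tpsi Tphi.
have [psiA psiK psi_le] := Tpsi.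
exists (extension psi); split; first split=> //; first split.
- by move=> I; apply: extension_radical_ideal Tphi I.
- move=> I J; rewrite !inE => rI rJ IJ.
  by apply/seteqP; split; apply/ext_le => //; rewrite IJ.
- move=> J rJ; exists (extension phi J).
    exact: extension_radical_ideal Tphi Tpsi J rJ.
  apply: (extension_unique dimD noethD noethD' Tpsi Tphi) => //.
    exact: extension_radical_ideal Tphi Tpsi J rJ.
  move=> X AX; apply: iff_sym; rewrite -{1}(psiK X AX).
  by apply: (sub_extension dimD' noethD' noethD Tphi Tpsi) => //; apply: psiA.
move=> I AI; apply: (extension_unique dimD noethD noethD' Tpsi Tphi).
- exact: principal_radical_radical_ideal.
- exact/principal_radical_radical_ideal/psiA.
- by move=> X AX; apply: iff_sym; apply: psi_le.
Qed.
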